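(* Let $K$ be a subfield of $\mathbb{R}$ and let $\mathcal{K}$ be a definably complete expansion of the ordered field $K$. Then $\mathcal{K}$ is definably Baire; that is, there is no set $Y\subseteq K\times K_{>0}$ definable in $\mathcal{K}$ such that (i) $Y_t$ is nowhere dense in $K$ for all $t\in K_{>0}$, (ii) $Y_s\subseteq Y_t$ for all $s,t\in K_{>0}$ with $s<t$, and (iii) $\bigcup_{t\in K_{>0}}Y_t=K$.
   Context: An expansion $\mathcal{K}$ of $K$ is definably complete if every bounded subset of $K$ definable in $\mathcal{K}$ (with parameters) has a supremum in $K$. For $Y\subseteq K^2$ and $t\in K$, $Y_t=\{b\in K:(b,t)\in Y\}$. Nowhere dense refers to the order topology on $K$. *)

(* Defs.v *)
From HB Require Import structures.
From mathcomp Require Import all_boot all_order all_algebra.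
From mathcomp Require Import all_classical all_reals topology.

Set Implicit Arguments.
Unset Strict Implicit.
Unset Printing Implicit Defensive.

Import Order.TTheory GRing.Theory Num.Theory.

Local Open Scope classical_set_scope.
Local Open Scope ring_scope.

Record language := Language {
  fsym : Type;
  farity : fsym -> nat;
  rsym : Type;
  rarity : rsym -> nat }.

Record structure (L : language) (M : Type) := Structure {
  finterp : forall f : fsym L, ('I_(farity f) -> M) -> M;
  rinterp : forall r : rsym L, ('I_(rarity r) -> M) -> Prop }.

(* Terms and formulas whose free variables are among n variables indexed by
   'I_n. A quantifier binds the variable ord0 of its body; the variable i of
   the context is lift ord0 i inside the body. *)
Inductive term (L : language) (n : nat) : Type :=
| TVar of 'I_n
| TApp (f : fsym L) of ('I_(farity f) -> term L n).

Inductive formula (L : language) : nat -> Type :=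
| FEq n of term L n & term L n : formula L n
| FRel n (r : rsym L) of ('I_(rarity r) -> term L n) : formula L n
| FNot n of formula L n : formula L n
| FAnd n of formula L n & formula L n : formula L n
| FOr n of formula L n & formula L n : formula L n
| FAll n of formula L n.+1 : formula L n
| FEx n of formula L n.+1 : formula L n.

Definition extend (M : Type) (n : nat) (a : M) (x : 'I_n -> M) : 'I_n.+1 -> M :=
  fun i => if unlift ord0 i is Some j then x j else a.

Fixpoint eval (L : language) (M : Type) (S : structure L M) (n : nat)
    (x : 'I_n -> M) (t : term L n) : M :=
  match t with
  | TVar i => x i
  | TApp f ts => finterp S (fun i => eval S x (ts i))
  end.

Fixpoint sat (L : language) (M : Type) (S : structure L M) (n : nat)
    (phi : formula L n) : ('I_n -> M) -> Prop :=
  match phi in formula _ n return ('I_n -> M) -> Prop with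
  | FEq _ s t => fun x => eval S x s = eval S x t
  | FRel _ r ts => fun x => rinterp S (fun i => eval S x (ts i))
  | FNot _ p => fun x => ~ sat S p x
  | FAnd _ p q => fun x => sat S p x /\ sat S q x
  | FOr _ p q => fun x => sat S p x \/ sat S q x
  | FAll _ p => fun x => forall a : M, sat S p (extend a x)
  | FEx _ p => fun x => exists a : M, sat S p (extend a x)
  end.

Definition lang_sum (L1 L2 : language) : language := {|
  fsym := fsym L1 + fsym L2;
  farity := fun f => match f with inl g => farity g | inr g => farity g end;
  rsym := rsym L1 + rsym L2;
  rarity := fun r => match r with inl s => rarity s | inr s => rarity s end |}.

(* The expansion of S by the interpretations T of the additional symbols L2. *)
Definition expansion (L1 L2 : language) (M : Type)
    (S : structure L1 M) (T : structure L2 M) : structure (lang_sum L1 L2) M :=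
  @Structure (lang_sum L1 L2) M
    (fun f => match f return ('I_(@farity (lang_sum L1 L2) f) -> M) -> M with
              | inl g => @finterp _ _ S g
              | inr g => @finterp _ _ T g
              end)
    (fun r => match r return ('I_(@rarity (lang_sum L1 L2) r) -> M) -> Prop with
              | inl s => @rinterp _ _ S s
              | inr s => @rinterp _ _ T s
              end).

Definition const_language (M : Type) : language := {|
  fsym := M; farity := fun=> 0%N;
  rsym := Empty_set; rarity := fun r => match r with end |}.

Definition const_structure (M : Type) : structure (const_language M) M :=
  @Structure (const_language M) M
    (fun (a : M) (_ : 'I_0 -> M) => a)
    (fun r : Empty_set => match r with end).

(* Definability with parameters: by a formula of the language enlarged by a
   constant symbol for each element of M. *)
Definition definable (L : language) (M : Type) (S : structure L M) (n : nat)
    (A : set ('I_n -> M)) : Prop :=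
  exists phi : formula (lang_sum L (const_language M)) n,
    A = [set x | sat (expansion S (const_structure M)) phi x].

Definition definable1 (L : language) (M : Type) (S : structure L M)
    (A : set M) : Prop :=
  definable S [set x : 'I_1 -> M | A (x ord0)].

Definition definable2 (L : language) (M : Type) (S : structure L M)
    (Y : set (M * M)) : Prop :=
  definable S [set x : 'I_2 -> M | Y (x ord0, x ord_max)].

Inductive ofield_fsym := OfZero | OfOne | OfAdd | OfOpp | OfMul.

Inductive ofield_rsym := OfLt.

Definition ofield_language : language := {|
  fsym := ofield_fsym;
  farity := fun f => match f with
                     | OfZero | OfOne => 0%N
                     | OfOpp => 1%N
                     | OfAdd | OfMul => 2%N
                     end;
  rsym := ofield_rsym;
  rarity := fun=> 2%N |}.

Definition ofield_structure (K : realFieldType) : structure ofield_language K :=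
  @Structure ofield_language K
    (fun f => match f return ('I_(@farity ofield_language f) -> K) -> K with
              | OfZero => fun=> 0
              | OfOne => fun=> 1
              | OfAdd => fun x => x ord0 + x ord_max
              | OfOpp => fun x => - x ord0
              | OfMul => fun x => x ord0 * x ord_max
              end)
    (fun r (x : 'I_2 -> K) => x ord0 < x ord_max).

(* The empty set, which has no supremum in K, is excluded. *)
Definition definably_complete (L : language) (K : realFieldType)
    (S : structure L K) : Prop :=
  forall A : set K, definable1 S A -> A !=set0 ->
    has_ubound A -> has_lbound A -> supremums A !=set0.

Definition nowhere_dense (T : topologicalType) (A : set T) : Prop :=
  (closure A)° = set0.

Definition definably_Baire (L : language) (K : realFieldType)
    (S : structure L K) : Prop :=
  ~ exists Y : set (K * K),
    [/\ definable2 S Y,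
        Y `<=` [set bt | 0 < bt.2],
        forall t : K, 0 < t ->
          nowhere_dense (ysection Y t : set (order_topology K)),
        forall s t : K, 0 < s -> 0 < t -> s < t ->
          ysection Y s `<=` ysection Y t
      & \bigcup_(t in [set t : K | 0 < t]) ysection Y t = [set: K]].

(* The type of elements of a subfield K of R, with the operations and the order
   of R restricted to K. *)
Record subfield_of (R : realType) (K : divringClosed R) := SubfieldOf {
  sfval :> R;
  sfvalP : sfval \in K }.

Section SubfieldTheory.

Variables (R : realType) (K : divringClosed R).
Local Notation F := (subfield_of K).

HB.instance Definition _ := [isSub for @sfval R K].
HB.instance Definition _ := [Choice of F by <:].
HB.instance Definition _ := [SubChoice_isSubIntegralDomain of F by <:].
HB.instance Definition _ := [SubIntegralDomain_isSubField of F by <:].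
HB.instance Definition _ := [SubChoice_isSubOrder of F by <: with ring_display].

Lemma sf_norm_subproof (x : F) : `|val x| \in K.
Proof. by case: (ger0P (val x)) => _; rewrite ?rpredN; apply: valP. Qed.

Definition sf_norm (x : F) : F := SubfieldOf (sf_norm_subproof x).

Lemma sf_leE (x y : F) : (x <= y) = (val x <= val y).
Proof. by []. Qed.

Lemma sf_ltE (x y : F) : (x < y) = (val x < val y).
Proof. by []. Qed.

Lemma sf_ler_normD (x y : F) : sf_norm (x + y) <= sf_norm x + sf_norm y.
Proof. exact: ler_normD. Qed.

Lemma sf_normr0_eq0 (x : F) : sf_norm x = 0 -> x = 0.
Proof. by move=> /(congr1 val) /= /normr0_eq0 x0; apply: val_inj. Qed.

Lemma sf_normrMn (x : F) n : sf_norm (x *+ n) = sf_norm x *+ n.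
Proof.
have valMn (y : F) m : sfval (y *+ m) = sfval y *+ m by exact: (raddfMn val).
by apply: val_inj; rewrite /= !valMn /= normrMn.
Qed.

Lemma sf_normrN (x : F) : sf_norm (- x) = sf_norm x.
Proof. by apply: val_inj; rewrite /= normrN. Qed.

HB.instance Definition _ := Num.Zmodule_isNormed.Build F F
  sf_ler_normD sf_normr0_eq0 sf_normrMn sf_normrN.

Lemma sf_addr_gt0 (x y : F) : 0 < x -> 0 < y -> 0 < x + y.
Proof. exact: addr_gt0. Qed.

Lemma sf_ger_leVge (x y : F) : 0 <= x -> 0 <= y -> (x <= y) || (y <= x).
Proof. by move=> _ _; apply: le_total. Qed.

Lemma sf_normrM : {morph (fun x : F => `|x|) : x y / x * y}.
Proof. by move=> x y; apply: val_inj; rewrite /= normrM. Qed.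

Lemma sf_ler_def (x y : F) : (x <= y) = (`|y - x| == y - x).
Proof. by rewrite -val_eqE /= sf_leE ler_def. Qed.

HB.instance Definition _ := Num.isNumRing.Build F
  sf_addr_gt0 sf_ger_leVge sf_normrM sf_ler_def.

End SubfieldTheory.

(* Main.v *)
(* Let X t be the closure of Y_t in [0,1] with the endpoints 0 and 1 added, and
   call the components of [0,1] \ X t gaps of level t.  In an archimedean field
   only finitely many gaps of a given level exceed a given length.  This yields
   a definable unbounded set D of positive levels that is finite below each
   bound: if some X t has arbitrarily close points, take the inverses of the
   gap lengths of X t; otherwise every X t is finite, and the times at which
   points enter the family will do.

   Along D = {d_0 < d_1 < ...} follow a path of nested gaps, choosing at each
   level the longest (then leftmost) gap inside the current one among those
   that replace its older endpoint.  Since a point x determines all the gaps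
   that contain it, "x lies on the path up to level d" is first order: no
   recursion has to be coded.  So the left endpoints of the path form a
   definable set, and its supremum lies in every gap of the path, hence in no
   X t, contradicting that the X t cover [0,1]. *)
From mathcomp Require Import all_boot all_order all_algebra.
From mathcomp Require Import all_classical all_reals topology.
From mathcomp Require Import lra.
Require Import Defs.

Set Implicit Arguments.
Unset Strict Implicit.
Unset Printing Implicit Defensive.

Import Order.TTheory GRing.Theory Num.Theory.

Local Open Scope classical_set_scope.
Local Open Scope ring_scope.

(** * Substitution of terms into first-order formulas *)

Lemma extend0 M n (a : M) (x : 'I_n -> M) : extend a x ord0 = a.
Proof. by rewrite /extend unlift_none. Qed.

Lemma extendS M n (a : M) (x : 'I_n -> M) i : extend a x (lift ord0 i) = x i.
Proof. by rewrite /extend liftK. Qed.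

Section Substitution.

Variables (L : language) (M : Type) (T : structure L M).

Fixpoint tsubst (n m : nat) (s : 'I_n -> term L m) (t : term L n) : term L m :=
  match t with
  | TVar i => s i
  | TApp f ts => TApp (fun i => tsubst s (ts i))
  end.

Lemma eval_tsubst (n m : nat) (s : 'I_n -> term L m) (x : 'I_m -> M) t :
  eval T x (tsubst s t) = eval T (fun i => eval T x (s i)) t.
Proof.
elim: t => //= f ts IH; congr finterp; apply/funext => i; exact: IH.
Qed.

Definition tlift n m (s : 'I_n -> term L m) : 'I_n.+1 -> term L m.+1 :=
  extend (TVar L ord0) (fun i => tsubst (fun j => TVar L (lift ord0 j)) (s i)).

Lemma eval_tlift n m (s : 'I_n -> term L m) (a : M) (x : 'I_m -> M) :
  (fun i => eval T (extend a x) (tlift s i)) =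
  extend a (fun i => eval T x (s i)).
Proof.
apply/funext => i; rewrite /tlift; case: (unliftP ord0 i) => [j ->|->].
  rewrite !extendS eval_tsubst; congr eval; apply/funext => k /=.
  by rewrite extendS.
by rewrite !extend0 /= extend0.
Qed.

(** Allows a definable predicate to be applied to arbitrary terms. The induction keeps [s] general,
    since a quantifier turns it into [tlift s]. *)
Lemma sat_subst n (phi : formula L n) m (s : 'I_n -> term L m) :
  exists psi : formula L m,
    forall x, sat T psi x <-> sat T phi (fun i => eval T x (s i)).
Proof.
elim: phi m s => {n}.
- move=> n t u m s; exists (FEq (tsubst s t) (tsubst s u)) => x /=.
  by rewrite !eval_tsubst.
- move=> n r ts m s; exists (FRel (fun i => tsubst s (ts i))) => x /=.
  by under eq_fun do rewrite eval_tsubst.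
- by move=> n p IH m s; have [q Hq] := IH m s; exists (FNot q) => x /=; rewrite Hq.
- move=> n p IHp q IHq m s; have [p' Hp] := IHp m s; have [q' Hq] := IHq m s.
  by exists (FAnd p' q') => x /=; rewrite Hp Hq.
- move=> n p IHp q IHq m s; have [p' Hp] := IHp m s; have [q' Hq] := IHq m s.
  by exists (FOr p' q') => x /=; rewrite Hp Hq.
- move=> n p IH m s; have [q Hq] := IH _ (tlift s); exists (FAll q) => x /=.
  by split=> H a; have := H a; rewrite Hq eval_tlift.
- move=> n p IH m s; have [q Hq] := IH _ (tlift s); exists (FEx q) => x /=.
  by split=> -[a H]; exists a; move: H; rewrite Hq eval_tlift.
Qed.

End Substitution.

(** * Closure properties of definable predicates *)

Section Definability.

Variables (F : realFieldType) (L : language) (T : structure L F).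

Let LF := lang_sum (lang_sum ofield_language L) (const_language F).
Let SF := expansion (expansion (ofield_structure F) T) (const_structure F).

Definition dfn n (P : ('I_n -> F) -> Prop) :=
  exists phi : formula LF n, forall x, P x <-> sat SF phi x.

Definition dterm n (f : ('I_n -> F) -> F) :=
  exists t : term LF n, forall x, f x = eval SF x t.

Lemma dterm_var n (i : 'I_n) : dterm (fun x => x i).
Proof. by exists (TVar LF i). Qed.

Lemma dterm_cst n (c : F) : @dterm n (fun=> c).
Proof. by exists (@TApp LF n (inr c) (fun i => TVar LF (widen_ord (leq0n n) i))). Qed.

Definition bin_arg A (a b : A) (i : 'I_2) := if i == ord0 then a else b.

Lemma dterm_add n f g : dterm f -> dterm g -> @dterm n (fun x => f x + g x).
Proof.
move=> [t ft] [u gu].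
by exists (@TApp LF n (inl (inl OfAdd)) (bin_arg t u)) => x /=; rewrite ft gu.
Qed.

Lemma dterm_mul n f g : dterm f -> dterm g -> @dterm n (fun x => f x * g x).
Proof.
move=> [t ft] [u gu].
by exists (@TApp LF n (inl (inl OfMul)) (bin_arg t u)) => x /=; rewrite ft gu.
Qed.

Lemma dterm_opp n f : dterm f -> @dterm n (fun x => - f x).
Proof.
by move=> [t ft]; exists (@TApp LF n (inl (inl OfOpp)) (fun=> t)) => x /=; rewrite ft.
Qed.

Lemma dfn_iff n (P Q : ('I_n -> F) -> Prop) :
  (forall x, Q x <-> P x) -> dfn P -> dfn Q.
Proof. by move=> QP [phi H]; exists phi => x; rewrite QP. Qed.

Lemma dfn_lt n f g : dterm f -> dterm g -> @dfn n (fun x => f x < g x).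
Proof.
move=> [t ft] [u gu].
by exists (@FRel LF n (inl (inl OfLt)) (bin_arg t u)) => x /=; rewrite ft gu.
Qed.

Lemma dfn_eq n f g : dterm f -> dterm g -> @dfn n (fun x => f x = g x).
Proof.
by move=> [t ft] [u gu]; exists (FEq t u) => x /=; rewrite ft gu.
Qed.

Lemma dfn_not n P : dfn P -> @dfn n (fun x => ~ P x).
Proof. by move=> [p Hp]; exists (FNot p) => x /=; rewrite Hp. Qed.

Lemma dfn_and n P Q : dfn P -> dfn Q -> @dfn n (fun x => P x /\ Q x).
Proof. by move=> [p Hp] [q Hq]; exists (FAnd p q) => x /=; rewrite Hp Hq. Qed.

Lemma dfn_or n P Q : dfn P -> dfn Q -> @dfn n (fun x => P x \/ Q x).
Proof. by move=> [p Hp] [q Hq]; exists (FOr p q) => x /=; rewrite Hp Hq. Qed.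

Lemma dfn_imp n P Q : dfn P -> dfn Q -> @dfn n (fun x => P x -> Q x).
Proof.
move=> dP dQ; apply: dfn_iff (dfn_or (dfn_not dP) dQ) => x.
by split=> [|[]//]; have [|] := pselect (P x); [right; auto | left].
Qed.

Lemma dfn_le n f g : dterm f -> dterm g -> @dfn n (fun x => f x <= g x).
Proof.
move=> df dg; apply: dfn_iff (dfn_not (dfn_lt dg df)) => x.
by rewrite leNgt; split=> /negP.
Qed.

Lemma dfn_all n (P : ('I_n -> F) -> F -> Prop) :
  @dfn n.+1 (fun y => P (fun i => y (lift ord0 i)) (y ord0)) ->
  dfn (fun x => forall a, P x a).
Proof.
move=> [p Hp]; exists (FAll p) => x /=; split=> H a; move: (H a);
  rewrite -Hp extend0; under [fun i => extend a x _]eq_fun do rewrite extendS; by [].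
Qed.

Lemma dfn_ex n (P : ('I_n -> F) -> F -> Prop) :
  @dfn n.+1 (fun y => P (fun i => y (lift ord0 i)) (y ord0)) ->
  dfn (fun x => exists a, P x a).
Proof.
move=> [p Hp]; exists (FEx p) => x /=; split=> -[a H]; exists a; move: H;
  rewrite -Hp extend0; under [fun i => extend a x _]eq_fun do rewrite extendS; by [].
Qed.

Definition dfn1 (P : F -> Prop) := @dfn 1 (fun x => P (x ord0)).
Definition dfn2 (P : F -> F -> Prop) := @dfn 2 (fun x => P (x ord0) (x ord_max)).

Lemma dfn1_app P n f : dfn1 P -> dterm f -> @dfn n (fun x => P (f x)).
Proof.
move=> [p Hp] [t ft]; have [q Hq] := sat_subst SF p (fun=> t).
by exists q => x; rewrite Hq ft -Hp.
Qed.

Lemma dfn2_app P n f g :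
  dfn2 P -> dterm f -> dterm g -> @dfn n (fun x => P (f x) (g x)).
Proof.
move=> [p Hp] [t ft] [u gu]; have [q Hq] := sat_subst SF p (bin_arg t u).
by exists q => x; rewrite Hq ft gu -Hp.
Qed.

End Definability.

Ltac dfn_step :=
  lazymatch goal with
  | |- dfn _ (fun x => forall a : Num.RealField.sort _, _) => apply: dfn_all => /=
  | |- dfn _ (fun x => ex _) => apply: dfn_ex => /=
  | |- dfn _ (fun x => _ /\ _) => apply: dfn_and
  | |- dfn _ (fun x => _ \/ _) => apply: dfn_or
  | |- dfn _ (fun x => ~ _) => apply: dfn_not
  | |- dfn _ (fun x => _ -> _) => apply: dfn_imp
  | |- dfn _ (fun x => is_true (_ < _)) => apply: dfn_lt
  | |- dfn _ (fun x => is_true (_ <= _)) => apply: dfn_le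
  | |- dfn _ (fun x => _ = _) => apply: dfn_eq
  | |- dterm _ (fun x => _ + _) => apply: dterm_add
  | |- dterm _ (fun x => _ * _) => apply: dterm_mul
  | |- dterm _ (fun x => - _) => apply: dterm_opp
  | |- dterm _ (fun x => x _) => exact: dterm_var
  | |- dterm _ (fun x => _) => exact: dterm_cst
  | H : dfn2 _ ?P |- dfn _ (fun x => ?P _ _) => apply: (dfn2_app H)
  | H : dfn1 _ ?P |- dfn _ (fun x => ?P _) => apply: (dfn1_app H)
  end.

(** * Suprema and infima of definable sets *)

Section DefinableBounds.

Variables (F : realFieldType) (L : language) (T : structure L F).
Hypothesis complete : definably_complete (expansion (ofield_structure F) T).

(** [definably_complete] also asks for a lower bound, so the set is cut off below its member [a];
    this does not change its upper bounds. *)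
Lemma dfn1_lub (P : F -> Prop) a u : dfn1 T P -> P a -> (forall x, P x -> x <= u) ->
  exists c, (forall x, P x -> x <= c) /\
            (forall v, (forall x, P x -> x <= v) -> c <= v).
Proof.
move=> dP Pa Pu.
have [phi Hphi] : dfn1 T (fun x => P x /\ a <= x) by rewrite /dfn1; repeat dfn_step.
have [||||c [cub clb]] := complete (A := [set x | P x /\ a <= x]).
- by exists phi; apply/funext => x; apply/propext; exact: Hphi.
- by exists a.
- by exists u => x [/Pu].
- by exists a => x [].
exists c; split=> [x Px|v Pv]; last by apply: clb => x [/Pv].
have [ax|xa] := leP a x; first by apply: cub.
by apply: le_trans (ltW xa) _; apply: cub; split.
Qed.

(** The infimum is the supremum of the lower bounds, which again form a definable set. *)
Lemma dfn1_glb (P : F -> Prop) a u : dfn1 T P -> P a -> (forall x, P x -> u <= x) ->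
  exists c, (forall x, P x -> c <= x) /\
            (forall v, (forall x, P x -> v <= x) -> v <= c).
Proof.
move=> dP Pa Pu.
have [||| c [c1 c2]] := @dfn1_lub (fun v => forall x, P x -> v <= x) u a.
- by rewrite /dfn1; repeat dfn_step.
- exact: Pu.
- by move=> v /(_ a Pa).
by exists c; split=> // x Px; apply: c2 => v /(_ x Px).
Qed.

End DefinableBounds.

(** * Finiteness from the archimedean property *)

Section Finiteness.

Variable F : realFieldType.
Hypothesis archi : forall x : F, exists n : nat, x < n%:R.

(** Each slice [n * e <= f a < (n + 1) * e] holds at most one element, and finitely many slices
    cover [[0, 1]] because the field is archimedean. *)
Lemma separated_finite (T : Type) (A : set T) (f : T -> F) (e : F) : 0 < e ->
    (forall a, A a -> 0 <= f a <= 1) ->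
    (forall a b, A a -> A b -> f a <= f b -> f b < f a + e -> a = b) ->
  finite_set A.
Proof.
move=> e0 f01 sep.
have fin n : finite_set (A `&` [set a | f a < n%:R * e]).
  elim: n => [|n IHn].
    rewrite (_ : _ `&` _ = set0)//; apply/seteqP; split=> // a [/f01 + /=].
    by rewrite mul0r => /andP[/le_gtF ->].
  pose B := A `&` [set a | n%:R * e <= f a < n.+1%:R * e].
  have finB : finite_set B.
    have [[b Bb]|/set0P/negP/negPn/eqP->//] := pselect (B !=set0).
    apply: (@sub_finite_set _ _ [set b]); last exact: finite_set1.
    have Buniq a c : B a -> B c -> f a <= f c -> a = c.
      move=> [Aa /andP[na _]] [Ac /andP[_ cn]] ac; apply: sep => //.
      by apply: (lt_le_trans cn); rewrite -natr1 mulrDl mul1r lerD2r.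
    move=> a Ba; have [ac|/ltW ca] := leP (f a) (f b); first exact: Buniq.
    by apply/esym/Buniq.
  apply: sub_finite_set (_ : _ `<=` (A `&` [set a | f a < n%:R * e]) `|` B) _.
    move=> a [Aa fa]; have [H|H] := ltP (f a) (n%:R * e); first by left.
    by right; split=> //; apply/andP.
  by rewrite finite_setU.
have [n en] := archi e^-1.
apply: sub_finite_set (fin n) => a Aa; split=> //=.
have /andP[_ /le_lt_trans] := f01 _ Aa; apply.
by rewrite -ltr_pdivrMr // div1r.
Qed.

(** [r] is a partial function given as a relation: inverse lengths and entry times will be described
    by conditions only. *)
Lemma functional_image_finite (T U : Type) (A : set T) (r : T -> U -> Prop) :
  finite_set A -> (forall a u v, r a u -> r a v -> u = v) ->
  finite_set [set u | exists2 a, A a & r a u].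
Proof.
move=> finA rfun.
apply: sub_finite_set (_ : _ `<=` \bigcup_(a in A) [set u | r a u]) _.
  by move=> u [a Aa ru]; exists a.
apply: bigcup_finite => // a _.
have [[u ru]|/set0P/negP/negPn/eqP->//] := pselect ([set u | r a u] !=set0).
by apply: sub_finite_set (finite_set1 u) => v rv; apply: rfun rv ru.
Qed.

Lemma finite_least (T : choiceType) (A : set T) (r : T -> T -> Prop) :
    (forall a b, r a b \/ r b a) -> (forall b a c, r a b -> r b c -> r a c) ->
    finite_set A -> A !=set0 ->
  exists2 a, A a & forall b, A b -> r a b.
Proof.
move=> tot tr /finite_seqP[s ->] {A}.
elim: s => [[a]//|a s IHs] _.
have rr b : r b b by case: (tot b b).
have [[b bs]|s0] := pselect ([set` s] !=set0); last first.
  exists a; first by rewrite /= mem_head.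
  move=> b /=; rewrite inE => /predU1P[->//|bs]; case: s0; by exists b.
have [m ms mle] := IHs (ex_intro _ b bs).
have [am|ma] := tot a m.
  exists a; first by rewrite /= mem_head.
  move=> c /=; rewrite inE => /predU1P[->//|/mle]; exact: tr.
exists m; first by rewrite /= inE ms orbT.
by move=> c /=; rewrite inE => /predU1P[->//|/mle].
Qed.

End Finiteness.

(** * Gaps of an increasing family of closed sets, and discrete sets of levels *)

Section Families.

Variables (F : realFieldType) (L : language) (T : structure L F).
Hypothesis complete : definably_complete (expansion (ofield_structure F) T).
Hypothesis archi : forall x : F, exists n : nat, x < n%:R.

Variable X : F -> F -> Prop.
Hypothesis X_dfn : dfn2 T X.
Hypothesis X_itv : forall t x : F, X t x -> 0 <= x <= 1.
Hypothesis X_0 : forall t, X t 0.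
Hypothesis X_1 : forall t, X t 1.
Hypothesis X_closed : forall t x : F,
  (forall u v, u < x -> x < v -> exists2 z, u < z < v & X t z) -> X t x.
Hypothesis X_meager : forall t a b : F, 0 < t -> 0 <= a -> a < b -> b <= 1 ->
  exists2 x, a < x < b & ~ X t x.
Hypothesis X_incr : forall s t x : F, 0 < s -> s <= t -> X s x -> X t x.
Hypothesis X_cover : forall x : F, 0 <= x <= 1 -> exists2 t : F, 0 < t & X t x.

(** Here and below, bare conjunctions and [exists] keep the predicates in the shapes that [dfn_step]
    recognizes. *)
Definition gap (t l r : F) := X t l /\ X t r /\ l < r /\ (forall z : F, l < z -> z < r -> ~ X t z).

(** The endpoints are the supremum of [X t] below [x] and its infimum above [x]; they exist by
    definable completeness and lie in [X t] by [X_closed]. *)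
Lemma gap_around t x : 0 <= x <= 1 -> ~ X t x ->
  exists l r, gap t l r /\ l < x /\ x < r.
Proof.
move=> /andP[x0 x1] nXx.
have [|||l [lub llb]] := @dfn1_lub _ _ _ complete (fun z => X t z /\ z <= x) 0 x.
- by rewrite /dfn1; repeat dfn_step.
- by split.
- by move=> z [].
have [|||r [rlb rub]] := @dfn1_glb _ _ _ complete (fun z => X t z /\ x <= z) 1 x.
- by rewrite /dfn1; repeat dfn_step.
- by split.
- by move=> z [].
have lx : l <= x by apply: llb => z [].
have xr : x <= r by apply: rub => z [].
have Xl : X t l.
  apply: X_closed => u v ul lv; apply: contrapT => H.
  have : l <= u; last by rewrite leNgt ul.
  apply: llb => z [Xz zx]; rewrite leNgt; apply/negP => uz; apply: H.
  by exists z => //; rewrite uz; apply: le_lt_trans lv; apply: lub.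
have Xr : X t r.
  apply: X_closed => u v ur rv; apply: contrapT => H.
  have : v <= r; last by rewrite leNgt rv.
  apply: rub => z [Xz zx]; rewrite leNgt; apply/negP => vz; apply: H.
  by exists z => //; rewrite vz andbT; apply: lt_le_trans ur _; apply: rlb.
have {lx}lx : l < x.
  by rewrite lt_neqAle lx andbT; apply: contra_notN nXx => /eqP <-.
have {xr}xr : x < r.
  by rewrite lt_neqAle xr andbT; apply: contra_notN nXx => /eqP ->.
exists l, r; split=> //; split=> //; split=> //; split; first exact: lt_trans xr.
move=> z lz zr Xz; have [zx|/ltW xz] := leP z x.
  by have := lub z (conj Xz zx); rewrite leNgt lz.
by have := rlb z (conj Xz xz); rewrite leNgt zr.
Qed.

Lemma gap_inside t y z : 0 < t -> X t y -> X t z -> y < z ->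
  exists l r, gap t l r /\ y <= l /\ r <= z.
Proof.
move=> t0 Xy Xz yz.
have /andP[y0 _] := X_itv Xy; have /andP[_ z1] := X_itv Xz.
have [x /andP[yx xz] nXx] := X_meager t0 y0 yz z1.
have [|l [r [[Xl [Xr [lr lrX]]] [lx xr]]]] := @gap_around t x _ nXx; first by lra.
exists l, r; split=> //; split; rewrite leNgt; apply/negP => H.
  by apply: (lrX y) => //; apply: lt_trans yx _.
by apply: (lrX z) => //; apply: lt_trans xz.
Qed.

(** An endpoint that differed would lie inside the other gap. Hence a point determines its gap at
    each level and can encode a path of gaps. *)
Lemma gap_unique t x l r p q : gap t l r -> gap t p q ->
  l < x -> x < r -> p < x -> x < q -> l = p /\ r = q.
Proof.
move=> [Xl [Xr [lr lrX]]] [Xp [Xq [pq pqX]]] lx xr px xq; split.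
  have [lp|pl|//] := ltgtP l p; exfalso.
    by apply: (lrX p) => //; apply: lt_trans xr.
  by apply: (pqX l) => //; apply: lt_trans xq.
have [rq|qr|//] := ltgtP r q; exfalso.
  by apply: (pqX r) => //; apply: lt_trans xr.
by apply: (lrX q) => //; apply: lt_trans xq.
Qed.

(** Distinct gaps of length at least [e] have left endpoints at least [e] apart. *)
Lemma long_gaps_finite (t e : F) : 0 < e ->
  finite_set [set g : F * F | gap t g.1 g.2 /\ e <= g.2 - g.1].
Proof.
move=> e0; apply: (@separated_finite _ archi _ _ (fun g => g.1) e) => //.
  by move=> [l r] [[/X_itv]].
move=> [l r] [p q] /= [gl el] [gp ep] lp ple.
have lr : l + e <= r by lra.
have pq : p + e <= q by lra.
(* If [p < l + e], the midpoint of [p] and [l + e] lies in both gaps. *)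
have [||||->->//] := @gap_unique t ((p + l + e) / 2) _ _ _ _ gl gp; lra.
Qed.

(** Close points of [X t] enclose short gaps, so the inverse lengths are unbounded; a bound on the
    inverse length leaves only long gaps, of which there are finitely many. *)
Lemma discrete_levels_of_crowded (t : F) : 0 < t ->
    (forall e : F, 0 < e -> exists y z : F, [/\ X t y, X t z, y < z & z < y + e]) ->
  exists D : F -> Prop, [/\ dfn1 T D, forall d, D d -> 0 < d,
    forall s : F, exists2 d : F, D d & s < d &
    forall s : F, finite_set [set d | D d /\ d <= s]].
Proof.
move=> t0 crowd.
exists (fun d => 0 < d /\ exists l r, gap t l r /\ d * (r - l) = 1).
split.
- by rewrite /dfn1 /gap; repeat dfn_step.
- by move=> d [].
- move=> s; pose u := `|s| + 1.
  have u0 : 0 < u by rewrite /u; have := normr_ge0 s; lra.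
  have [|y [z [Xy Xz yz zy]]] := crowd u^-1; first by rewrite invr_gt0.
  have [l [r [glr [yl rz]]]] := gap_inside t0 Xy Xz yz.
  have lr : 0 < r - l by case: glr => _ [_ []]; lra.
  exists (r - l)^-1; first split; rewrite ?invr_gt0 //.
    by exists l, r; split=> //; rewrite mulVf // gt_eqF.
  apply: (@le_lt_trans _ _ u); first by rewrite /u; have := ler_norm s; lra.
  by rewrite -[ltLHS]invrK ltf_pV2 ?posrE ?invr_gt0 //; lra.
- move=> s; pose u := `|s| + 1.
  have u0 : 0 < u by rewrite /u; have := normr_ge0 s; lra.
  have su : s <= u by rewrite /u; have := ler_norm s; lra.
  have u'0 : 0 < u^-1 by rewrite invr_gt0.
  apply: sub_finite_set (functional_image_finite
    (r := fun g d => d * (g.2 - g.1) = 1) (long_gaps_finite t u'0) _).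
    move=> d /= [[d0 [l [r [glr dlr]]]] ds]; exists (l, r) => //=; split=> //.
    have lr : 0 < r - l by case: glr => _ [_ []]; lra.
    rewrite -div1r ler_pdivrMr // -dlr mulrC ler_pM2l //; lra.
  move=> [l r] d d' /= H H'; have lr0 : r - l != 0.
    by apply: contra_eq_neq H => ->; rewrite mulr0 eq_sym oner_eq0.
  by apply: (mulIf lr0); rewrite H H'.
Qed.

(** The levels are the entry times of points. For [u > 0] the set [X u] is finite, so few points
    enter before [u]; a point missed by [X u] enters at [u] or later, so entry times are
    unbounded. *)
Lemma discrete_levels_of_sparse :
    (forall t : F, 0 < t -> exists2 e : F, 0 < e &
      forall y z, X t y -> X t z -> y < z -> y + e <= z) ->
  exists D : F -> Prop, [/\ dfn1 T D, forall d, D d -> 0 < d,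
    forall s : F, exists2 d : F, D d & s < d &
    forall s : F, finite_set [set d | D d /\ d <= s]].
Proof.
move=> sparse.
exists (fun d => 0 < d /\ exists x, (forall s, 0 < s -> s < d -> ~ X s x) /\
  (forall s, d < s -> X s x)).
split.
- by rewrite /dfn1; repeat dfn_step.
- by move=> d [].
- move=> s; pose u := `|s| + 1.
  have u0 : 0 < u by rewrite /u; have := normr_ge0 s; lra.
  have su : s < u by rewrite /u; have := ler_norm s; lra.
  have [x /andP[x0 x1] nXx] := X_meager u0 (lexx 0) ltr01 (lexx 1).
  have [|t t0 Xtx] := @X_cover x; first by lra.
  have [|||d [dub dlb]] := @dfn1_lub _ _ _ complete (fun s => 0 < s /\ ~ X s x) u t.
  + by rewrite /dfn1; repeat dfn_step.
  + by split.
  + move=> v [v0 nXv]; rewrite leNgt; apply/negP => tv; apply: nXv.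
    exact: X_incr (ltW tv) Xtx.
  have ud : u <= d by apply: dub.
  exists d; last exact: lt_le_trans ud.
  split; first exact: lt_le_trans ud.
  exists x; split=> v.
    move=> v0 vd Xv; have : d <= v; last by rewrite leNgt vd.
    apply: dlb => w [w0 nXw]; rewrite leNgt; apply/negP => vw; apply: nXw.
    exact: X_incr (ltW vw) Xv.
  move=> dv; apply: contrapT => nXv; have : v <= d; last by rewrite leNgt dv.
  by apply: dub; split=> //; lra.
- move=> s; pose u := `|s| + 1.
  have u0 : 0 < u by rewrite /u; have := normr_ge0 s; lra.
  (* The strict inequality matters: a point is only known to belong to the family after its entry
     time, not at it. *)
  have su : s < u by rewrite /u; have := ler_norm s; lra.
  have [e e0 sep] := sparse _ u0.
  have finX : finite_set [set x | X u x].
    apply: (@separated_finite _ archi _ _ id e) => // [x /X_itv //|x y Xx Xy /= xy yx].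
    move: xy; rewrite le_eqVlt => /predU1P[//|/(sep _ _ Xx Xy)]; lra.
  apply: sub_finite_set (functional_image_finite
    (r := fun x d => 0 < d /\ (forall s, 0 < s -> s < d -> ~ X s x) /\
      (forall s, d < s -> X s x)) finX _).
    move=> d /= [[d0 [x [H1 H2]]] ds]; exists x => //.
    by apply: H2; exact: le_lt_trans su.
  have H x d d' : 0 < d -> (forall s, d < s -> X s x) ->
      (forall s, 0 < s -> s < d' -> ~ X s x) -> d' <= d.
    move=> d0 Hd Hd'; rewrite leNgt; apply/negP => dd'.
    by apply: (Hd' ((d + d') / 2)); [lra|lra|apply: Hd; lra].
  move=> x d d' [d0 [Hd1 Hd2]] [d'0 [Hd'1 Hd'2]].
  by apply/eqP; rewrite eq_le (H x d') //= (H x d).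
Qed.

Lemma exists_discrete_levels :
  exists D : F -> Prop, [/\ dfn1 T D, forall d, D d -> 0 < d,
    forall s : F, exists2 d : F, D d & s < d &
    forall s : F, finite_set [set d | D d /\ d <= s]].
Proof.
have [[t [t0 crowd]]|sparse] := pselect (exists t : F, 0 < t /\
    forall e : F, 0 < e -> exists y z : F, [/\ X t y, X t z, y < z & z < y + e]).
  exact: discrete_levels_of_crowded crowd.
apply: discrete_levels_of_sparse => t t0; apply: contrapT => H; apply: sparse.
exists t; split=> // e e0; apply: contrapT => H'; apply: H; exists e => // y z Xy Xz yz.
by rewrite leNgt; apply/negP => zy; apply: H'; exists y, z.
Qed.

(* Replacing the older endpoint at each refinement makes both endpoints of a
   path of gaps move; a rule without such memory could keep one of them fixed
   for ever. *)
Definition older (a b : F) := exists e : F, 0 < e /\ X e a /\ ~ X e b.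

(** The last clause is conditional: a gap whose interior [X t] does not meet is kept unchanged. *)
Definition admissible (t l r p q : F) := gap t p q /\ l <= p /\ q <= r /\
  ((exists z : F, l < z /\ z < r /\ X t z) ->
   (older l r -> l < p) /\ (~ older l r -> q < r)).

Definition precedes (p q p' q' : F) := q' - p' < q - p \/ (q' - p' = q - p /\ p <= p').

Definition step (t l r p q : F) := admissible t l r p q /\
  forall p' q' : F, admissible t l r p' q' -> precedes p q p' q'.

(** If some [z] cuts the gap, [gap_inside] is applied on the side of [z] away from the endpoint to
    be replaced. Only finitely many gaps are at least as long as the one found, so a best one
    exists. *)
Lemma step_exists (s t l r : F) : 0 < s -> s < t -> gap s l r -> exists p q, step t l r p q.
Proof.
move=> s0 st [Xl [Xr [lr lrX]]]; have t0 : 0 < t := lt_trans s0 st.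
have Xtl : X t l by exact: X_incr (ltW st) Xl.
have Xtr : X t r by exact: X_incr (ltW st) Xr.
have [p0 [q0 [adm0 pq0]]] : exists p q, admissible t l r p q /\ p < q.
  have [[z [lz [zr Xz]]]|nz] := pselect (exists z : F, l < z /\ z < r /\ X t z).
    have [old|young] := pselect (older l r).
      have [p [q [g [zp qr]]]] := gap_inside t0 Xz Xtr zr.
      exists p, q; split; last by case: g => _ [_ []].
      split=> //; split; [lra|split=> // _; split=> // _; lra].
    have [p [q [g [lp qz]]]] := gap_inside t0 Xtl Xz lz.
    exists p, q; split; last by case: g => _ [_ []].
    split=> //; split=> //; split; [lra|move=> _; split=> // _; lra].
  exists l, r; split=> //; split; last by split=> //; split.
  by split=> //; split=> //; split=> // z lz zr Xz; apply: nz; exists z.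
have len0 : 0 < q0 - p0 by lra.
pose A := [set g : F * F | admissible t l r g.1 g.2 /\ q0 - p0 <= g.2 - g.1].
have [||||[p q] /= [adm len] best] :=
    @finite_least _ A (fun g h => precedes g.1 g.2 h.1 h.2).
- move=> [p q] [p' q'] /=; rewrite /precedes.
  by have [||->] := ltgtP (q - p) (q' - p'); [auto..|case: (leP p p') => [|/ltW]; auto].
- move=> [p' q'] [p q] [p'' q''] /=; rewrite /precedes.
  by case=> [?|[? ?]] [?|[? ?]]; [left; lra|left; lra|left; lra|right; split; lra].
- by apply: sub_finite_set (long_gaps_finite t len0) => g [[]].
- by exists (p0, q0); split.
exists p, q; split=> // p' q' adm'.
have [le|lt] := leP (q0 - p0) (q' - p'); first exact: (best (p', q')).
by left; exact: lt_le_trans len.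
Qed.

Lemma step_unique t l r p q p' q' :
  step t l r p q -> step t l r p' q' -> p = p' /\ q = q'.
Proof.
move=> [a b] [a' b'].
by have [?|[? ?]] := b _ _ a'; have [?|[? ?]] := b' _ _ a; split; lra.
Qed.

(** * The path of gaps along a discrete set of levels *)

Section Path.

Variable D : F -> Prop.
Hypothesis D_dfn : dfn1 T D.
Hypothesis D_gt0 : forall d : F, D d -> 0 < d.
Hypothesis D_unbounded : forall s : F, exists2 d : F, D d & s < d.
Hypothesis D_finite : forall s : F, finite_set [set d | D d /\ d <= s].

(** This enumeration lives outside the structure and serves only to reason about the definable
    path. *)
Lemma levels_enum : exists lev : nat -> F,
  [/\ forall n, D (lev n), forall m n, (lev m < lev n) = (m < n)%N &
      forall d, D d -> exists n, d = lev n].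
Proof.
have le_tot (a b : F) : a <= b \/ b <= a by case: (leP a b) => [|/ltW]; auto.
have nextP (s : F) : exists d, [/\ D d, s < d & forall f, D f -> s < f -> d <= f].
  have [d0 Dd0 sd0] := D_unbounded s.
  have [||d [Dd sd dd0] dmin] := @finite_least _
    [set d | [/\ D d, s < d & d <= d0]] (fun a b => a <= b) le_tot (@le_trans _ _).
  - by apply: sub_finite_set (D_finite d0) => d [].
  - by exists d0; split.
  exists d; split=> // f Df sf; have [fd0|/ltW] := leP f d0; first exact: dmin.
  exact: le_trans.
have [next nextH] := choice nextP.
(* [n.+1] iterations, because the starting point 0 is not a level. *)
pose lev n := iter n.+1 next 0.
have levD n : D (lev n) by case: (nextH (iter n next 0)).
have lev_lt : {homo lev : m n / (m < n)%N >-> m < n}.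
  by apply: homo_ltn => [? ? ?|n]; [exact: lt_trans|case: (nextH (lev n))].
have lev_mono : {mono lev : m n / (m <= n)%N >-> m <= n} by exact: le_mono.
exists lev; split=> // [m n|d Dd]; first exact: leW_mono.
(* A missed level [d] would lie above every [lev n], giving a finite set of levels without a largest
   element. *)
apply: contrapT => nlev.
have lev_d n : lev n < d.
  elim: n => [|n IHn].
    have [_ _ /(_ d Dd (D_gt0 Dd))] := nextH 0.
    by rewrite le_eqVlt => /predU1P[E|//]; case: nlev; exists 0%N.
  have [_ _ /(_ d Dd IHn)] := nextH (lev n).
  by rewrite le_eqVlt => /predU1P[E|//]; case: nlev; exists n.+1.
have [||||_ [m _ <-] mmax] := @finite_least _ (lev @` setT) (fun a b => b <= a).
- by move=> a b; exact: le_tot.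
- by move=> b a c ab bc; exact: le_trans bc ab.
- by apply: sub_finite_set (D_finite d) => _ [n _ <-]; split=> //; exact: ltW.
- by exists (lev 0%N); exists 0%N.
have := mmax (lev m.+1); rewrite leNgt lev_lt // => H.
by suff: false by []; apply: H; exists m.+1.
Qed.

Definition consecutive (e e' : F) := D e /\ D e' /\ e < e' /\ (forall f, D f -> e < f -> e' <= f).

(** By [gap_unique] the quantified gaps are determined by [x], so the formula says that the history
    of [x] up to level [d] obeys [step]; [l0] and [r0] fix the gap at the first level. *)
Definition on_path (l0 r0 d x : F) := l0 < x /\ x < r0 /\
  (forall e e' l r p q : F, consecutive e e' -> e' <= d -> gap e l r -> gap e' p q ->
    l < x -> x < r -> p < x -> x < q -> step e' l r p q).

Lemma path_left_ends_dfn (l0 r0 : F) : dfn1 T (fun a => exists d x b : F,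
  D d /\ gap d a b /\ a < x /\ x < b /\ on_path l0 r0 d x).
Proof.
rewrite /dfn1 /on_path /consecutive /step /precedes /admissible /older /gap.
by repeat dfn_step.
Qed.

(** The path is built by recursion outside the structure, and its left endpoints are shown to form
    the definable set above. Both endpoints move again after every level, so the supremum [c] is
    interior to each gap. *)
Lemma no_discrete_levels : False.
Proof.
have [lev [levD lev_lt levE]] := levels_enum.
have lev0 n : 0 < lev n by exact: D_gt0.
have lev_le m n : (lev m <= lev n) = (m <= n)%N by rewrite leNgt lev_lt -leqNgt.
have consecP e e' : consecutive e e' -> exists k, e = lev k /\ e' = lev k.+1.
  move=> [/levE[k ->] [/levE[m ->] [km kmin]]]; exists k; split=> //.
  apply/eqP; rewrite eq_le kmin ?lev_lt // lev_le.
  by move: km; rewrite lev_lt.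
have consec_lev k : consecutive (lev k) (lev k.+1).
  split=> //; split=> //; split=> [|_ /levE[m ->]]; first by rewrite lev_lt.
  by rewrite lev_lt lev_le.
have [l0 [r0 [g0 _]]] := gap_inside (lev0 0%N) (X_0 _) (X_1 _) ltr01.
have nextP (ng : nat * (F * F)) : exists h : F * F, gap (lev ng.1) ng.2.1 ng.2.2 ->
    step (lev ng.1.+1) ng.2.1 ng.2.2 h.1 h.2.
  (* [choice] needs a value for every [ng]; pairs that are not gaps get the default [ng.2]. *)
  have [g|ng'] := pselect (gap (lev ng.1) ng.2.1 ng.2.2); last by exists ng.2.
  have [||p [q pq]] := @step_exists _ (lev ng.1.+1) _ _ _ _ g; rewrite ?lev_lt //.
  by exists (p, q).
have [next nextH] := choice nextP.
pose I := fix I n := if n is m.+1 then next (m, I m) else (l0, r0).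
pose l n := (I n).1; pose r n := (I n).2.
have Ig n : gap (lev n) (l n) (r n).
  by elim: n => [//|n IHn]; have [[]] := nextH (n, I n) IHn.
have Is n : step (lev n.+1) (l n) (r n) (l n.+1) (r n.+1) := nextH (n, I n) (Ig n).
have lr n : l n < r n by case: (Ig n) => _ [_ []].
have lS n : l n <= l n.+1 by case: (Is n) => -[_ []].
have rS n : r n.+1 <= r n by case: (Is n) => -[_ [_ []]].
have lm : {homo l : m n / (m <= n)%N >-> m <= n}.
  by apply: homo_leq => // ? ? ?; exact: le_trans.
have rm : {homo r : m n / (m <= n)%N >-> n <= m}.
  by apply: homo_leq => // ? ? ? ab bc; exact: le_trans bc ab.
have path_unique n x a b : on_path l0 r0 (lev n) x -> gap (lev n) a b ->
    a < x -> x < b -> a = l n.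
  move=> [lx [xr onp]] gab ax xb.
  suff [lnx xrn] : l n < x /\ x < r n by have [] := gap_unique gab (Ig n) ax xb lnx xrn.
  have: (n <= n)%N by [].
  (* Induction on [k <= n], with the level [n] of [on_path] fixed: if [x] lies in the [k]-th gap,
     [step_unique] identifies its next gap with the chosen one. *)
  elim: {1 3 4}n => [//|k IHk] kn; have [lkx xrk] := IHk (ltnW kn).
  have nXx : ~ X (lev k.+1) x.
    by move/(X_incr (lev0 _)) => /(_ (lev n)); rewrite lev_le; case: gab => _ [_ [_ H]] /(_ kn); exact: H.
  have x01 : 0 <= x <= 1.
    case: gab => /X_itv/andP[? _] [/X_itv/andP[_ ?] _]; lra.
  have [p [q [gpq [px xq]]]] := gap_around x01 nXx.
  have := onp _ _ _ _ _ _ (consec_lev k) _ (Ig k) gpq lkx xrk px xq.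
  by rewrite lev_le => /(_ kn) /(step_unique (Is k))[-> ->].
have path_mem n : exists d x b, D d /\ gap d (l n) b /\ l n < x /\ x < b /\ on_path l0 r0 d x.
  exists (lev n), ((l n + r n) / 2), (r n); have lrn := lr n.
  do 2!split=> //; split; first by lra.
  split; first by lra.
  have inI k : (k <= n)%N -> l k < (l n + r n) / 2 /\ (l n + r n) / 2 < r k.
    by move=> kn; have := lm _ _ kn; have := rm _ _ kn; split; lra.
  have [? ?] := inI 0%N isT; split=> //; split=> //.
  move=> e e' a b p q /consecP[k [-> ->]]; rewrite lev_le => kn gab gpq.
  move=> ax xb px xq.
  have [lk rk] := inI _ (ltnW kn); have [lk1 rk1] := inI _ kn.
  have [-> ->] := gap_unique gab (Ig k) ax xb lk rk.
  by have [-> ->] := gap_unique gpq (Ig k.+1) px xq lk1 rk1.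
have l_le_r m n : l m <= r n.
  have := lm _ _ (leq_maxl m n); have := rm _ _ (leq_maxr m n).
  by have := lr (maxn m n); lra.
have [|c [cub clb]] := dfn1_lub complete (path_left_ends_dfn l0 r0) (path_mem 0%N) (u := r 0%N).
  move=> a [d [x [b [/levE[n ->] [gab [ax [xb onp]]]]]]].
  by rewrite (path_unique _ _ _ _ onp gab ax xb).
have lc n : l n <= c by exact: cub (path_mem n).
have cr n : c <= r n.
  apply: clb => a [d [x [b [/levE[m ->] [gab [ax [xb onp]]]]]]].
  by rewrite (path_unique _ _ _ _ onp gab ax xb).
(* Otherwise the gap would stay constant from level [n] on, and its midpoint would belong to no
   [X t]. *)
have refine n : exists2 m, (n <= m)%N & [/\ l m = l n, r m = r n &
    exists z, l m < z /\ z < r m /\ X (lev m.+1) z].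
  apply: contrapT => nref.
  have const m : (n <= m)%N -> l m = l n /\ r m = r n.
    elim: m => [|m IHm]; first by rewrite leqn0 => /eqP ->.
    rewrite leq_eqVlt => /predU1P[->//|]; rewrite ltnS => nm.
    have [lmn rmn] := IHm nm.
    have nz z : l m < z -> z < r m -> ~ X (lev m.+1) z.
      by move=> ? ? ?; apply: nref; exists m => //; split=> //; exists z.
    have [Xl [Xr _]] := Ig m.+1.
    have := lS m; rewrite le_eqVlt => /predU1P[lE|ll]; last first.
      by case: (nz _ ll _ Xl); exact: lt_le_trans (rS m).
    have := rS m; rewrite le_eqVlt => /predU1P[rE|rr]; last first.
      by case: (nz _ _ rr Xr); exact: le_lt_trans (lS m) _.
    by rewrite -lE rE.
  have x01 : 0 <= (l n + r n) / 2 <= 1.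
    by case: (Ig n) => /X_itv/andP[? _] [/X_itv/andP[_ ?] [? _]]; lra.
  have [t t0 Xt] := X_cover x01.
  have [_ /levE[k ->] tk] := D_unbounded t.
  have [lk rk] := const _ (leq_maxl n k).
  have [_ [_ [_]]] := Ig (maxn n k).
  rewrite lk rk => /(_ ((l n + r n) / 2)); have := lr n => ? H; apply: H; [lra|lra|].
  apply: X_incr Xt => //; apply: le_trans (ltW tk) _; rewrite lev_le; exact: leq_maxr.
have new n z : ~ X (lev n) z -> forall a, X (lev n) a -> older a z.
  by move=> nXz a Xa; exists (lev n).
have inner n z : l n < z -> z < r n -> ~ X (lev n) z by case: (Ig n) => _ [_ [_]]; apply.
have Xl n : X (lev n) (l n) by case: (Ig n).
have Xr n : X (lev n) (r n) by case: (Ig n) => _ [].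
have older_asym a b : older a b -> ~ older b a.
  move=> [e [e0 [Xa nXb]]] [f [f0 [Xb nXa]]].
  have [ef|/ltW fe] := leP e f; first exact/nXa/(X_incr e0 ef).
  exact/nXb/(X_incr f0 fe).
(* If the right endpoint is replaced first, it becomes the newer one, so the next refinement must
   replace the left endpoint. *)
have l_moves n : exists m, l n < l m.
  have [m nm [lmn rmn z]] := refine n.
  have [[_ [_ [_ /(_ z) [old young]]]] _] := Is m.
  have [o|/young rlt] := pselect (older (l m) (r m)); first by exists m.+1; rewrite -lmn; exact: old.
  have := lS m; rewrite le_eqVlt lmn => /predU1P[E|]; last by exists m.+1.
  have [m' mm' [lmm rmm z']] := refine m.+1.
  have [[_ [_ [_ /(_ z') [old' _]]]] _] := Is m'.
  exists m'.+1; rewrite E -lmm; apply: old'; rewrite lmm rmm -E -lmn.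
  apply: (new m) => //; apply: inner => //.
  by rewrite lmn E.
(* Symmetric; [older_asym] enters because the rule moves the right endpoint when [older] fails. *)
have r_moves n : exists m, r m < r n.
  have [m nm [lmn rmn z]] := refine n.
  have [[_ [_ [_ /(_ z) [old young]]]] _] := Is m.
  have [/old llt|y] := pselect (older (l m) (r m)); last by exists m.+1; rewrite -rmn; exact: young.
  have := rS m; rewrite le_eqVlt rmn => /predU1P[E|]; last by exists m.+1.
  have [m' mm' [lmm rmm z']] := refine m.+1.
  have [[_ [_ [_ /(_ z') [_ young']]]] _] := Is m'.
  exists m'.+1; rewrite -E -rmm; apply: young'; rewrite lmm rmm E -rmn.
  apply: older_asym; apply: (new m) => //; apply: inner => //.
  by rewrite rmn -E.
have c01 : 0 <= c <= 1.
  case: (Ig 0%N) => /X_itv/andP[? _] [/X_itv/andP[_ ?] _].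
  have := lc 0%N; have := cr 0%N; lra.
have [t t0 Xt] := X_cover c01.
have [_ /levE[k ->] tk] := D_unbounded t.
apply: (inner k c).
- by have [m lkm] := l_moves k; exact: lt_le_trans (lc m).
- by have [m rkm] := r_moves k; exact: le_lt_trans rkm.
- exact: X_incr (ltW tk) Xt.
Qed.

End Path.

Lemma no_meager_cover : False.
Proof.
have [D [D_dfn D_gt0 D_unbounded D_finite]] := exists_discrete_levels.
exact: no_discrete_levels D_dfn D_gt0 D_unbounded D_finite.
Qed.

End Families.

(** * Reduction to closed subsets of the unit interval *)

Lemma definably_Baire_archimedean (F : realFieldType) (L : language)
    (T : structure L F) : (forall x : F, exists n : nat, x < n%:R) ->
  definably_complete (expansion (ofield_structure F) T) ->
  definably_Baire (expansion (ofield_structure F) T).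
Proof.
move=> archi complete [Y [[phi Yphi] _ Ynd Yincr Ycover]].
pose Z (x t : F) := Y (x, t).
have Z_dfn : dfn2 T Z.
  by exists phi => x; rewrite -/(([set x | sat _ phi x] : set _) x) -Yphi.
have Zcover x : exists2 t : F, 0 < t & Z x t.
  have [t t0 Yxt] : (\bigcup_(t in [set t : F | 0 < t]) ysection Y t) x by rewrite Ycover.
  by exists t => //; move: Yxt; rewrite /ysection /= inE.
clear phi Yphi Ycover.
(* Closure is spelled out with open intervals to be first order; adding 0 and 1 ensures that every
   gap has endpoints in [X t]. *)
pose clZ (t x : F) := forall u v : F, u < x -> x < v -> exists y : F, u < y /\ y < v /\ Z y t.
pose X (t x : F) := 0 <= x /\ x <= 1 /\ (x = 0 \/ x = 1 \/ clZ t x).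
apply: (@no_meager_cover F L T complete archi X).
- by rewrite /dfn2 /X /clZ; repeat dfn_step.
- by move=> t x [-> [-> _]].
- by move=> t; split=> //; split=> //; left.
- by move=> t; split=> //; split=> //; right; left.
- move=> t x Hx.
  have x0 : 0 <= x.
    rewrite leNgt; apply/negP => x0; have [||z /andP[_ z0] [z0' _]] := Hx (x - 1) 0 => //; lra.
  have x1 : x <= 1.
    rewrite leNgt; apply/negP => x1; have [||z /andP[z1 _] [_ [z1' _]]] := Hx 1 (x + 1) => //; lra.
  split=> //; split=> //.
  have [->|xn0] := eqVneq x 0; first by left.
  have [->|xn1] := eqVneq x 1; first by right; left.
  right; right => u v ux xv.
  (* Clipping the window to []0, 1[] excludes the adjoined endpoints, so the point found satisfies
     [clZ t]. *)
  have [||z /andP[] + + [_ [_ Xz]]] := Hx (Num.max u 0) (Num.min v 1).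
  + by rewrite gt_max ux lt_neqAle eq_sym xn0.
  + by rewrite lt_min xv lt_neqAle xn1.
  rewrite gt_max lt_min => /andP[uz z0] /andP[zv z1].
  by case: Xz => [E|[E|]]; [lra..|exact].
- move=> t a b t0 a0 ab b1; apply: contrapT => H.
  (* If [X t] contained []a, b[], which avoids 0 and 1, the midpoint would be interior to the
     closure of the section of [Y] at [t]. *)
  have: (closure (ysection Y t : set (order_topology F)))° ((a + b) / 2); last by rewrite Ynd.
  rewrite /interior /= order_nbhs_itv; exists `]a, b[%O.
    by rewrite /= in_itv /=; split=> //; lra.
  move=> x; rewrite /= in_itv /= => /andP[ax xb] B.
  rewrite order_nbhs_itv => -[i [iopen xi] iB].
  have [_ [_ Xx]] : X t x.
    by apply: contrapT => nXx; apply: H; exists x; rewrite ?ax.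
  have {}Xx : clZ t x by case: Xx => [E|[E|//]]; lra.
  suff [u [v [ux [xv uvi]]]] : exists u v : F, u < x /\ x < v /\
      forall y, u < y -> y < v -> y \in i.
    have [y [uy [yv Zy]]] := Xx u v ux xv.
    by exists y; split; [rewrite /ysection /= inE|apply/iB/uvi].
  (* A basic open set of the order topology may be unbounded; a missing end is replaced by [x - 1]
     or [x + 1]. *)
  case: i {iB} iopen xi => [[[] p|[]] [[] q|[]]] //= _; rewrite in_itv /=.
  + move=> /andP[px xq]; exists p, q; do 2!split=> //.
    by move=> y py yq; rewrite in_itv /= py.
  + move=> px; exists p, (x + 1); rewrite ?andbT in px; split; first by lra.
    by split=> [|y py yq]; [lra|rewrite in_itv /= py].
  + move=> px; exists (x - 1), q; split; first by lra.
    by split=> // y py yq; rewrite in_itv /= yq.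
  + move=> _; exists (x - 1), (x + 1); split; first by lra.
    by split=> [|y _ _]; [lra|rewrite in_itv].
- move=> s t x s0 st [x0 [x1 Xx]]; split=> //; split=> //.
  case: Xx => [|[|clx]]; [by left|by right; left|right; right => u v ux xv].
  have [y [uy [yv Zy]]] := clx u v ux xv; exists y; do 2!split=> //.
  move: st; rewrite le_eqVlt => /predU1P[<-//|st].
  have := Yincr s t s0 (lt_trans s0 st) st y.
  by rewrite /ysection /= !inE; exact.
- move=> x /andP[x0 x1].
  have [t t0 Zxt] := Zcover x; exists t => //; split=> //; split=> //.
  by right; right=> u v ux xv; exists x.
Qed.

Lemma subfield_archimedean (R : realType) (K : divringClosed R) (x : subfield_of K) :
  exists n : nat, x < n%:R.
Proof.
exists (Num.bound `|val x|); rewrite sf_ltE (rmorph_nat val).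
by apply: le_lt_trans (ler_norm _) _; exact/archi_boundP/normr_ge0.
Qed.

Theorem theoremD (R : realType) (K : divringClosed R) (L : language)
    (S : structure L (subfield_of K)) :
  definably_complete (expansion (ofield_structure (subfield_of K)) S) ->
  definably_Baire (expansion (ofield_structure (subfield_of K)) S).
Proof. exact: definably_Baire_archimedean (@subfield_archimedean R K). Qed.
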